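(* Let $c>0$, $M>0$, $\Omega=[x_0,x_1]$, and let $u:\Omega\times[0,T]\to\mathbb{R}$ be a smooth solution of the heat equation $$u_t=\frac{1}{4c}u_{xx}$$ with height bound $|u|<M$ and Lipschitz bound $\operatorname{Lip}u(\cdot,0)<\infty$. Then for $t>0$ and $x$ in the interior of $\Omega$, $$u_x(x,t)\le2N\sqrt{\frac{c}{\pi t}}\exp\!\left(-\left[\mathrm{erf}^{-1}\!\left(\frac{u(x,t)}{N}\right)\right]^2\right),\qquad\text{where}\quad N=M\left[\mathrm{erf}\!\left(\frac{\sqrt{c}\,\operatorname{dist}(x,\partial\Omega)}{2\sqrt{t}}\right)\right]^{-1}.$$
   Context: $\mathrm{erf}(x)=\frac{2}{\sqrt\pi}\int_0^xe^{-y^2}\,dy$, and $\mathrm{erf}^{-1}:(-1,1)\to\mathbb{R}$ is its inverse. $\operatorname{Lip}$ denotes the Lipschitz constant. *)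

(* Defs.v *)
From mathcomp Require Import all_boot all_order all_algebra.
From mathcomp Require Import all_classical all_reals all_analysis.

Set Implicit Arguments.
Unset Strict Implicit.
Unset Printing Implicit Defensive.

Import Order.TTheory GRing.Theory Num.Theory.
Import numFieldNormedType.Exports.

Local Open Scope classical_set_scope.
Local Open Scope ring_scope.

Section error_function.
Context {R : realType}.

(* The integral from 0 to x is oriented: it changes sign when x < 0. *)
Definition erf (x : R) : R :=
  2 / Num.sqrt pi *
  (if 0 <= x then \int[lebesgue_measure]_(y in `[0, x]) expR (- y ^+ 2)
   else - \int[lebesgue_measure]_(y in `[x, 0]) expR (- y ^+ 2))%R.

(* [pinv] gives the inverse on the range ]-1, 1[ of erf, and the value is junk
   outside that interval. *)
Definition erf_inv : R -> R := pinv setT erf.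

End error_function.

Section lipschitz_and_distance.
Context {R : realType}.

Definition Lip (A : set R) (f : R -> R) : \bar R :=
  ereal_sup [set (`|f p.1 - f p.2| / `|p.1 - p.2|)%:E
            | p in [set p : R * R | [/\ A p.1, A p.2 & p.1 != p.2]]].

Definition boundary (A : set R) : set R := closure A `\` interior A.

Definition dist (x : R) (A : set R) : R := fine (edist_inf A x).

End lipschitz_and_distance.

Section smoothness_on_a_rectangle.
Context {R : realType}.

(* Derivatives relative to a set A: two-sided in the interior of an interval A,
   one-sided at the endpoints belonging to A. *)
Definition derivable_within (A : set R) (f : R -> R) (x : R) : Prop :=
  cvg (h^-1 * (f (h + x) - f x) @[h --> within [set h | A (h + x)] 0^']).

Definition derive_within (A : set R) (f : R -> R) (x : R) : R :=
  lim (h^-1 * (f (h + x) - f x) @[h --> within [set h | A (h + x)] 0^']).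

Lemma derive_within_interior (A : set R) (f : R -> R) (x : R) :
  interior A x -> derive_within A f x = derive1 f x.
Proof.
rewrite /interior /= => xA; rewrite /derive_within /derive1.
have cx : (h + x) @[h --> (0 : R)] --> x.
  by rewrite -[X in _ --> X]add0r; apply: cvgD; [exact: cvg_id|exact: cvg_cst].
have Ax : \forall h \near (0 : R)^', A (h + x).
  by apply: nbhs_dnbhs; exact: cx.
suff -> : within [set h | A (h + x)] (0 : R)^' = (0 : R)^' by [].
apply/seteqP; split=> P /= HP; last by apply: filterS HP => h Ph _.
have HP1 : \forall h \near (0 : R)^', A (h + x) -> P h by [].
by apply: filterS2 HP1 Ax => h HAP Ah; exact: HAP.
Qed.

Definition dx (X : set R) (u : R -> R -> R) : R -> R -> R :=
  fun x t => derive_within X (u ^~ t) x.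

Definition dt (I : set R) (u : R -> R -> R) : R -> R -> R :=
  fun x t => derive_within I (u x) t.

Fixpoint Ck_on (k : nat) (X I : set R) (u : R -> R -> R) : Prop :=
  {within X `*` I, continuous (fun p : R * R => u p.1 p.2)} /\
  if k is k'.+1 then
    [/\ forall x t, X x -> I t ->
          derivable_within X (u ^~ t) x /\ derivable_within I (u x) t,
        Ck_on k' X I (dx X u) & Ck_on k' X I (dt I u)]
  else True.

Definition smooth_on (X I : set R) (u : R -> R -> R) : Prop :=
  forall k, Ck_on k X I u.

Definition heat_solution (c : R) (X I : set R) (u : R -> R -> R) : Prop :=
  forall x t, X x -> I t -> dt I u x t = 1 / (4 * c) * dx X (dx X u) x t.

End smoothness_on_a_rectangle.

(* Main.v *)
Require Import Defs.
From mathcomp Require Import all_boot all_order all_algebra.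
From mathcomp Require Import all_classical all_reals all_analysis.
From mathcomp Require Import ring lra.
Import Order.TTheory GRing.Theory Num.Theory.
Import numFieldNormedType.Exports.
Local Open Scope classical_set_scope.
Local Open Scope ring_scope.

(* Fix (x, t), let d be the distance from x to the boundary, and compare u on
   [x - d, x + d] with the self-similar solution
   v (y, s) = N erf (sqrt c (y - z) / sqrt s), where z is chosen so that
   v (x, t) = u (x, t).  Then |z - x| < d / 2, so the choice of N makes
   D = v - u negative at x - d and positive at x + d for all s <= t.  For small
   s, |v| >= M > |u| away from z, while near z the slope of v exceeds the bound
   of u_x; hence there are no a <= b with D (a, s) > 0 > D (b, s).  As
   - D (a, s) D (b, s) solves the two-dimensional heat equation, the maximum
   principle on the triangle a <= b propagates this up to time t.  Since
   D (x, t) = 0, this forces u_x <= v_x at (x, t), and v_x (x, t) is the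
   right-hand side of the theorem. *)

(** * Calculus of the error function and its inverse *)

Section erf_facts.
Context {R : realType}.
Notation mu := (@lebesgue_measure R).
Implicit Types x y : R.

Definition erf' x : R := 2 / Num.sqrt pi * gauss_fun x.

Lemma erf'_gt0 x : 0 < erf' x.
Proof. by rewrite mulr_gt0 ?expR_gt0// divr_gt0 ?sqrtr_gt0 ?pi_gt0. Qed.

Lemma integrable_gauss_fun (a b : R) :
  mu.-integrable `[a, b] (EFin \o gauss_fun).
Proof.
apply: continuous_compact_integrable; first exact: segment_compact.
by apply: continuous_subspaceT; exact: continuous_gauss_fun.
Qed.

Lemma integral_gauss_fun_split (a b c : R) : a <= b -> b <= c ->
  (\int[mu]_(y in `[a, c]) gauss_fun y =
   \int[mu]_(y in `[a, b]) gauss_fun y + \int[mu]_(y in `[b, c]) gauss_fun y)%R.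
Proof.
move=> ab bc; apply/eqP; rewrite addrC -subr_eq; apply/eqP.
have := @Rintegral_itvB R gauss_fun (BLeft a) (BRight c) b
  (integrable_gauss_fun a c).
rewrite !bnd_simp => /(_ ab bc) ->.
rewrite Rintegral_itv_obnd_cbnd//.
by apply: integrableS (integrable_gauss_fun b c) => //; exact: subset_itv_oc_cc.
Qed.

(** A common lower limit below both [x] and 0 removes the case distinction on the sign of [x], so
    that the fundamental theorem of calculus applies. *)
Lemma erfE (a x : R) : a <= x -> a <= 0 ->
  erf x = 2 / Num.sqrt pi *
    (\int[mu]_(y in `[a, x]) gauss_fun y -
     \int[mu]_(y in `[a, 0%R]) gauss_fun y)%R.
Proof.
move=> ax a0; rewrite /erf; congr (_ * _); case: ifPn => [x0|].
  by rewrite (integral_gauss_fun_split _ _ _ a0 x0) addrAC subrr add0r.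
rewrite -ltNge => /ltW x0.
by rewrite (integral_gauss_fun_split _ _ _ ax x0) opprD addrA subrr add0r.
Qed.

Lemma is_derive_erf x : is_derive x 1 (@erf R) (erf' x).
Proof.
(* Strictly below both [x] and 0, so that [erfE] holds on a neighbourhood of [x]. *)
pose a : R := - `|x| - 1.
have ax : a < x by rewrite /a; have := ler_norm (- x); rewrite normrN; lra.
have a0 : a < 0 by rewrite /a; have := normr_ge0 x; lra.
pose F z := (\int[mu]_(y in `[a, z]) gauss_fun y)%R.
have [dF F'] : derivable F x 1 /\ derive1 F x = gauss_fun x.
  apply: (@continuous_FTC1_closed R gauss_fun a x (x + 1)) => //.
  - by rewrite ltrDl.
  - exact: integrable_gauss_fun.
  - exact: continuous_gauss_fun.
have FF : is_derive x 1 F (gauss_fun x).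
  by split; [exact: dF|rewrite -derive1E].
apply: (@near_eq_is_derive _ _ _
  (fun z => (2 / Num.sqrt pi) * (F z - F 0))).
  near=> z; apply/esym/erfE; [apply: ltW|exact: ltW].
  by near: z; exact: lt_nbhsr.
rewrite /erf'.
have := @is_deriveZ _ _ _ (F - cst (F 0)) (2 / Num.sqrt pi) x 1 _
  (is_deriveB FF (is_derive_cst (F 0) x 1)).
by rewrite subr0.
Unshelve. all: by end_near. Qed.

Lemma continuous_erf : continuous (@erf R).
Proof.
move=> x; apply/differentiable_continuous/derivable1_diffP.
by have [] := is_derive_erf x.
Qed.

Lemma ltr_erf : {mono (@erf R) : x y / x < y}.
Proof.
apply: leW_mono; apply: le_mono => x y xy.
have [||w _ /eqP] := @MVT R erf erf' x y xy.
- by move=> w _; exact: is_derive_erf.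
- by apply: continuous_subspaceT; exact: continuous_erf.
by rewrite subr_eq => /eqP ->; rewrite ltrDr mulr_gt0 ?erf'_gt0 ?subr_gt0.
Qed.

Lemma erf0 : erf 0 = 0 :> R.
Proof. by rewrite (erfE 0 0)// subrr mulr0. Qed.

(** The Gaussian is even, so the sum [f] below has derivative zero. *)
Lemma erfN x : erf (- x) = - erf x.
Proof.
pose f y := erf (- y) + erf y : R.
suff : f x = f 0.
  by rewrite /f oppr0 erf0 addr0 => /eqP; rewrite addr_eq0 => /eqP.
apply: is_derive_0_is_cst => y.
have dN : is_derive y 1 (fun z : R => - z) (- 1).
  exact: is_deriveN.
have := is_deriveD
  (@is_derive1_comp R erf _ y _ _ (is_derive_erf (- y)) dN) (is_derive_erf y).
by rewrite mulrN1 /erf' /gauss_fun sqrrN addNr.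
Qed.

(** The bound puts [y] between [erf (- q)] and [erf q], so the intermediate value theorem gives a
    preimage and [pinv] does not return its junk value. *)
Lemma erf_invK (y q : R) : `|y| < erf q -> erf (erf_inv y) = y.
Proof.
move=> yq; have q0 : 0 < q by rewrite -ltr_erf erf0 (le_lt_trans _ yq).
rewrite /erf_inv pinvK// inE.
have [|||z _ zy] := @IVT R erf (- q) q y.
- by lra.
- by apply: continuous_subspaceT; exact: continuous_erf.
- rewrite erfN minEle maxEle; move: yq; rewrite ltr_norml => /andP[? ?].
  by case: ifP; lra.
- by exists z.
Qed.

Lemma erf_inv_bound (y q : R) : `|y| < erf q -> `|erf_inv y| < q.
Proof.
move=> yq; rewrite ltr_norml -ltr_erf erfN -[X in _ && X]ltr_erf.
rewrite (erf_invK _ _ yq).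
by move: yq; rewrite ltr_norml.
Qed.

End erf_facts.

(** * First- and second-order derivative tests *)

Section derivative_tests.
Context {R : realType}.
Implicit Types (f : R -> R) (a b k : R).

Lemma is_derive_gt0_near f a k : is_derive a 1 f k -> 0 < k ->
  exists2 e : R, 0 < e & forall h : R, 0 < h < e -> f (a - h) < f a < f (a + h).
Proof.
move=> [dfa <-] k0.
have : h^-1 *: (f (h *: 1 + a) - f a) @[h --> 0^'] --> 'D_1 f a.
  exact: dfa.
move=> /cvgr_gt /(_ _ k0) [e /= e0 fe]; exists e => // h /andP[h0 he].
have := fe h; have := fe (- h).
rewrite /ball_ /= !sub0r !normrN gtr0_norm//= oppr_eq0 gt_eqF// => /(_ he isT).
rewrite invrN scaleNr oppr_gt0 pmulr_rlt0 ?invr_gt0// [(- h)%:A]mulr1 => fl.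
move=> /(_ he isT); rewrite pmulr_rgt0 ?invr_gt0// [h%:A]mulr1 => fr.
by rewrite (addrC a) (addrC a h) -subr_lt0 fl -subr_gt0 fr.
Qed.

(** If [k] were positive, then [f' a = 0] would make [f'] positive just to the right of [a], and the
    mean value theorem would lift [f] above [f a] there. *)
Lemma second_derivative_at_max f (f' : R -> R) (l r a k : R) : l < a < r ->
  (forall x, l < x < r -> is_derive x 1 f (f' x)) -> is_derive a 1 f' k ->
  (forall x, l < x < r -> f x <= f a) -> k <= 0.
Proof.
move=> /andP[la ar] df df' fa; rewrite leNgt; apply/negP => k0.
have f'a : f' a = 0.
  have lar : l < a < r by rewrite la.
  have dfa := df _ lar.
  have d0 : is_derive a 1 f 0.
    apply: (@derive1_at_max _ _ l r) => [|x||x]; rewrite ?in_itv//=.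
    - by rewrite (le_trans (ltW la) (ltW ar)).
    - by move=> /df [].
    - exact: fa.
  by case: dfa => _ <-; case: d0 => _ ->.
have [e e0 f'e] := is_derive_gt0_near _ _ _ df' k0.
have [m m0 [me mr]] : exists2 m : R, 0 < m & m < e /\ a + m < r.
  exists (Num.min (e / 2) ((r - a) / 2)).
    by rewrite lt_min; apply/andP; split; lra.
  by split; [|rewrite -ltrBrDl]; rewrite gt_min; apply/orP; [left|right]; lra.
pose b := a+m.
have bP : a < b /\ b < r /\ b - a < e by rewrite /b; lra.
case: bP => ab [br be].
have dab x : a <= x <= b -> is_derive x 1 f (f' x) by move=> ?; apply: df; lra.
have [||x] := @MVT _ f f' a b ab.
- by move=> x; rewrite in_itv/= => ?; apply: dab; lra.
- apply: derivable_within_continuous => x; rewrite in_itv/= => xab.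
  by have [] := dab x xab.
rewrite in_itv/= => /andP[ax xb] E.
have : f' a < f' (a + (x - a)) by have /f'e /andP[] : 0 < x - a < e by lra.
rewrite addrC subrK f'a => f'x.
have : f b <= f a by apply: fa; lra.
have : 0 < f' x * (b - a) by rewrite mulr_gt0// subr_gt0.
by lra.
Qed.

End derivative_tests.

(** * Relative continuity under composition *)

Lemma within_continuous_precomp {U V W : topologicalType}
    (A : set V) (B : set W) (f : V -> U) (g : W -> V) :
  continuous g -> (forall x, B x -> A (g x)) ->
  {within A, continuous f} -> {within B, continuous (f \o g)}.
Proof.
move=> cg BA /subspace_continuousP cf; apply/subspace_continuousP => x Bx.
apply: cvg_comp (cf _ (BA _ Bx)) => Q /= AQ.
have : nbhs x [set z | A (g z) -> Q (g z)] by exact: (cg x _ AQ).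
by apply: filterS => z AQz Bz; apply/AQz/BA.
Qed.

Lemma continuous_pair {T U V : topologicalType} (f : T -> U) (g : T -> V) :
  continuous f -> continuous g -> continuous (fun x => (f x, g x)).
Proof. by move=> cf cg x; apply: cvg_pair; [exact: cf|exact: cg]. Qed.

(** * A maximum principle for sign changes of solutions of the heat equation *)

Section sign_change.
Context {R : realType}.
Variables (l r s0 t k : R) (D Dy Dyy : R -> R -> R).
Hypothesis k_gt0 : 0 < k.
Hypothesis s0t : s0 < t.
Hypothesis contD :
  {within `[l, r] `*` `[s0, t], continuous (fun p : R * R => D p.1 p.2)}.
Hypothesis derD : forall y s, l < y < r -> s0 < s < t ->
  [/\ is_derive y 1 (D ^~ s) (Dy y s), is_derive y 1 (Dy ^~ s) (Dyy y s) &
      is_derive s 1 (D y) (k * Dyy y s)].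
Hypothesis leftD : forall s, s0 <= s <= t -> D l s <= 0.
Hypothesis rightD : forall s, s0 <= s <= t -> 0 <= D r s.
Hypothesis initD : forall a b, l <= a -> a <= b -> b <= r ->
  0 < D a s0 -> D b s0 < 0 -> False.

(** Truncating each factor of [P] keeps two negative factors from giving a positive product. *)
Let pos (x : R) := Num.max x 0.

Let pos_ge0 x : 0 <= pos x.
Proof. by rewrite le_max lexx orbT. Qed.

Let pos_gt0 (x : R) : 0 < x -> pos x = x.
Proof. by move=> x0; apply/max_idPl/ltW. Qed.

Let gt0_pos x : 0 < pos x -> 0 < x.
Proof. by rewrite lt_max ltxx orbF. Qed.

Let le_pos x : x <= pos x.
Proof. by rewrite le_max lexx. Qed.

Let K : set (R * R * R) :=
  ((`[l, r] `*` `[l, r]) `*` `[s0, t]) `&` [set p | p.1.1 <= p.1.2].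

(* On the set where both factors are positive, (a, b, s) |-> - D a s * D b s
   solves the two-dimensional heat equation. *)
Let P (p : R * R * R) : R :=
  pos (D p.1.1 p.2) * pos (- D p.1.2 p.2) * (t - p.2).

Let compactK : compact K.
Proof.
apply: compact_closedI.
  by do 2?apply: compact_setX; exact: segment_compact.
have -> : [set p : R * R * R | p.1.1 <= p.1.2] =
    (fun p => p.1.2 - p.1.1) @^-1` [set x | 0 <= x].
  by apply/seteqP; split => p /=; rewrite subr_ge0.
apply: (@preimage_closed _ _ (fun p : R * R * R => p.1.2 - p.1.1)
  [set x | 0 <= x]).
  move=> p _; apply: cvgB.
  - by apply: continuous_comp; [exact: cvg_fst|exact: cvg_snd].
  - by apply: continuous_comp; [exact: cvg_fst|exact: cvg_fst].
exact: closed_ge.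
Qed.

Let contP : {within K, continuous P}.
Proof.
have cpos (f : R * R * R -> R) p : f q @[q --> within K (nbhs p)] --> f p ->
    pos (f q) @[q --> within K (nbhs p)] --> pos (f p).
  move=> cf; apply: cvg_comp cf _.
  apply: (@continuous_max _ _ (fun x => x) (fun=> 0)).
    exact: cvg_id.
  exact: cvg_cst.
have cD (g : R * R * R -> R * R) p : continuous g ->
    (forall q, K q -> (`[l, r] `*` `[s0, t]) (g q)) -> K p ->
    D (g q).1 (g q).2 @[q --> within K (nbhs p)] --> D (g p).1 (g p).2.
  move=> cg Kg; move: p; apply/subspace_continuousP.
  exact: (within_continuous_precomp _ _ _ _ cg Kg contD).
apply/subspace_continuousP => p Kp; apply: cvgM; last first.
  by apply: cvgB; [exact: cvg_cst|apply: cvg_within_filter; exact: cvg_snd].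
apply: cvgM.
- apply: (cpos (fun q => D q.1.1 q.2)).
  apply: (cD (fun p : R * R * R => (p.1.1, p.2))) => //.
  + apply: continuous_pair => q; last exact: cvg_snd.
    by apply: continuous_comp; [exact: cvg_fst|exact: cvg_fst].
  + by move=> q [[[? ?] ?] _].
- apply: (cpos (fun q => - D q.1.2 q.2)); apply: cvgN.
  apply: (cD (fun p : R * R * R => (p.1.2, p.2))) => //.
  + apply: continuous_pair => q; last exact: cvg_snd.
    by apply: continuous_comp; [exact: cvg_fst|exact: cvg_snd].
  + by move=> q [[[? ?] ?] _].
Qed.

(** A forbidden pair makes the maximum of [P] over the compact set [K] positive. The factor [t - s]
    in [P] keeps that maximum away from the final time, and its derivative -1 supplies the strict
    sign that contradicts the derivative tests. *)
Let no_sign_change_lt a b s : l <= a -> a <= b -> b <= r -> s0 <= s < t ->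
  0 < D a s -> D b s < 0 -> False.
Proof.
move=> la ab br /andP[s0s st] Da Db.
have inK a' b' s' : l <= a' -> a' <= b' -> b' <= r -> s0 <= s' <= t ->
    ((a', b'), s') \in K.
  move=> ? ? ? ?; rewrite inE; split => //=; split => //=.
  by split; rewrite /= in_itv/=; lra.
have [|[[a1 b1] s1]] := compact_EVT_max _ compactK contP.
  by exists ((a, b), s); apply/set_mem; apply: inK; rewrite // s0s ltW.
rewrite inE => -[[[/= + +] +] ab1].
rewrite !in_itv/= => /andP[la1 _] /andP[_ br1] /andP[s0s1 s1t] Pmax.
have : 0 < P ((a1, b1), s1).
  have /Pmax : ((a, b), s) \in K by apply: inK; rewrite // s0s ltW.
  apply: lt_le_trans; rewrite /P/= !pos_gt0 ?oppr_gt0//.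
  by rewrite !mulr_gt0 ?oppr_gt0 ?subr_gt0.
rewrite /P /= => P1.
have : t - s1 != 0 by apply: contraTneq P1 => ->; rewrite mulr0 ltxx.
rewrite subr_eq0 => ts1.
have {ts1}s1t' : s1 < t by rewrite lt_neqAle eq_sym ts1.
have DD0 : 0 < pos (D a1 s1) * pos (- D b1 s1).
  by move: P1; rewrite pmulr_lgt0 ?subr_gt0.
have Da1 : 0 < D a1 s1.
  apply: gt0_pos; rewrite lt_neqAle pos_ge0 andbT eq_sym.
  by apply: contraTneq DD0 => ->; rewrite mul0r ltxx.
have Db1 : 0 < - D b1 s1.
  apply: gt0_pos; rewrite lt_neqAle pos_ge0 andbT eq_sym.
  by apply: contraTneq DD0 => ->; rewrite mulr0 ltxx.
(* The hypotheses at [s0], [l] and [r] exclude the corresponding faces of [K], and on the diagonal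
   the two factors cannot both be positive; so the maximum lies where the equation holds. *)
have s0s1' : s0 < s1.
  rewrite lt_neqAle s0s1 andbT; apply/eqP => E; subst s1.
  by apply: (initD _ _ la1 ab1 br1 Da1); rewrite -oppr_gt0.
have la1' : l < a1.
  rewrite lt_neqAle la1 andbT; apply/eqP => E; subst a1.
  by move: Da1; rewrite ltNge leftD ?s0s1.
have br1' : b1 < r.
  rewrite lt_neqAle br1 andbT; apply/eqP => E; subst b1.
  by move: Db1; rewrite oppr_gt0 ltNge rightD ?s0s1.
have ab1' : a1 < b1.
  rewrite lt_neqAle ab1 andbT; apply/eqP => E; subst b1; lra.
move: Pmax; rewrite /P /= (pos_gt0 _ Da1) (pos_gt0 _ Db1) => Pmax.
have s1P : s0 < s1 < t by rewrite s0s1'.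
have ts1 : 0 < t - s1 by rewrite subr_gt0.
have [|Da_y Da_yy Da_s] := derD a1 s1 _ s1P; first lra.
have [|Db_y Db_yy Db_s] := derD b1 s1 _ s1P; first lra.
(* With [b1] and [s1] fixed, the positive factors cancel, so [a1] maximizes [D ^~ s1] on []l, b1[];
   likewise [b1] minimizes it on []a1, r[]. *)
have Da2 : Dyy a1 s1 <= 0.
  apply: (@second_derivative_at_max _ (D ^~ s1) (Dy ^~ s1) l b1 a1) => //.
  - by rewrite la1'.
  - by move=> x xlb; have [] := derD x s1 _ s1P; first lra.
  - move=> x /andP[lx xb]; have /Pmax /= : ((x, b1), s1) \in K.
      by apply: inK; rewrite ?s0s1//; exact: ltW.
    rewrite (pos_gt0 _ Db1) !ler_pM2r//; exact/le_trans/le_pos.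
have Db2 : 0 <= Dyy b1 s1.
  rewrite -oppr_le0.
  apply: (@second_derivative_at_max _ (fun y => - D y s1) (fun y => - Dy y s1)
    a1 r b1).
  - by rewrite ab1'.
  - move=> x xlb; have [|Dx_y _ _] := derD x s1 _ s1P; first lra.
    exact: (is_deriveN Dx_y).
  - move=> x /andP[ax xr]; have /Pmax /= : ((a1, x), s1) \in K.
      by apply: inK; rewrite ?s0s1//; exact: ltW.
    rewrite (pos_gt0 _ Da1) ler_pM2r// ler_pM2l//; exact/le_trans/le_pos.
(* The time profile of [P] at [(a1, b1)] without truncation. It agrees with [P] near [s1], where
   both factors stay positive, hence is critical at [s1]. *)
pose h s := D a1 s * (- D b1 s) * (t - s).
have dh : is_derive s1 1 h
   ((D a1 s1 * - (k * Dyy b1 s1) + (- D b1 s1) * (k * Dyy a1 s1)) * (t - s1)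
     - D a1 s1 * - D b1 s1).
  have Db_N := is_deriveN Db_s.
  have dt := is_deriveB (is_derive_cst t s1 1) (is_derive_id s1 (1 : R)).
  apply: is_derive_eq (is_deriveM (is_deriveM Da_s Db_N) dt) _.
  rewrite /GRing.scale/= !fctE; ring.
have [e e0 he] : exists2 e : R, 0 < e & forall s', `|s' - s1| < e ->
   [/\ s0 < s' < t, 0 < D a1 s' & 0 < - D b1 s'].
  have cvg_der (f : R -> R) f' :
      is_derive s1 1 f f' -> f x @[x --> s1] --> f s1.
    by move=> [/derivable1_diffP/differentiable_continuous].
  have H3 := cvgr_gt _ (cvg_der _ _ Da_s) _ Da1.
  have H2 := cvgr_gt _ (cvg_der _ _ (is_deriveN Db_s)) _ Db1.
  have H1 : \forall s' \near s1, s0 < s' < t.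
    by apply: filterS2 (lt_nbhsr s0s1') (lt_nbhsl s1t') => s' -> ->.

  have [e e0 he] := filterI H1 (filterI (H2 _) (H3 _)).
  exists e => // s' s's1; have [|//] := he s'; first by rewrite /ball_/= distrC.
  by move=> ? [].
have : is_derive s1 1 h 0.
  apply: (@derive1_at_max _ _ (s1 - e) (s1 + e)).
  - by lra.
  - move=> s'; rewrite in_itv/= => s'e.
    have s'P : s0 < s' < t by case: (he s') => //; rewrite ltr_norml; lra.
    have [|_ _ Da_s'] := derD a1 s' _ s'P; first lra.
    have [|_ _ Db_s'] := derD b1 s' _ s'P; first lra.
    have Db_N := is_deriveN Db_s'.
    apply: derivableM; last exact: derivableB.
    by apply: derivableM; [case: Da_s'|case: Db_N].
  - by rewrite in_itv/=; lra.
  - move=> s'; rewrite in_itv/= => s'e.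
    have [s'P Da' Db'] : [/\ s0 < s' < t, 0 < D a1 s' & 0 < - D b1 s'].
      by apply: he; rewrite ltr_norml; lra.
    have /Pmax /= : ((a1, b1), s') \in K by apply: inK => //; lra.
    by rewrite !pos_gt0.
(* Vanishing of the derivative of [h] equates a nonpositive multiple of [t - s1] with the positive
   product [D a1 s1 * - D b1 s1]. *)
case: dh => _ dhE [_]; rewrite dhE => E0.
have : 0 < D a1 s1 * - D b1 s1 by rewrite mulr_gt0.
have : D a1 s1 * (k * Dyy b1 s1) >= 0 by rewrite !mulr_ge0// ltW.
have : (- D b1 s1) * (k * - Dyy a1 s1) >= 0.
  by rewrite !mulr_ge0// ?oppr_ge0// ltW// -?oppr_gt0.
by move: E0; nra.
Qed.

(** Adds the final time, where [P] vanishes identically: by continuity the two strict signs persist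
    at slightly earlier times. *)
Lemma no_sign_change a b s : l <= a -> a <= b -> b <= r -> s0 <= s <= t ->
  0 < D a s -> D b s < 0 -> False.
Proof.
move=> la ab br /andP[s0s]; rewrite le_eqVlt => /predU1P[->|st]; last first.
  by apply: no_sign_change_lt; rewrite ?s0s.
move=> Da Db.
have cvgD y : l <= y <= r ->
    D y s' @[s' --> within `[s0, t] (nbhs t)] --> D y t.
  move=> lyr.
  have : {within `[s0, t], continuous (D y)}.
    apply: (within_continuous_precomp _ _ _ (fun s' : R => (y, s')) _ _ contD).
      by apply: continuous_pair => q; [exact: cvg_cst|exact: cvg_id].
    by move=> s' s's; split => //=; rewrite in_itv.
  move=> /subspace_continuousP; apply; rewrite /= in_itv/= lexx ltW//.
have lar : l <= a <= r by lra.
have lbr : l <= b <= r by lra.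
have [e e0 De] : exists2 e : R, 0 < e & forall s', `|t - s'| < e ->
    s0 <= s' <= t -> 0 < D a s' /\ D b s' < 0.
  have [e e0 De] := filterI (cvgr_gt _ (cvgD _ lar) _ Da)
    (cvgr_lt _ (cvgD _ lbr) _ Db).
  by exists e => // s' /De De' s's; split; apply De'; rewrite /= in_itv.
have [m m0 [me mt]] : exists2 m : R, 0 < m & m < e /\ s0 <= t - m.
  exists (Num.min (e / 2) (t - s0)); first by rewrite lt_min divr_gt0 ?subr_gt0.
  split; first by rewrite gt_min gtr_pMr// invf_lt1// ltr1n.
  by rewrite lerBrDr -lerBrDl ge_min lexx orbT.
have [||] := De (t - m).
- by rewrite subKr gtr0_norm.
- by lra.
- by apply: no_sign_change_lt; lra.
Qed.

End sign_change.

(** * Distance to the boundary of an interval *)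

Lemma boundary_itvcc {R : realType} (x0 x1 : R) : x0 <= x1 ->
  boundary `[x0, x1] = [set x0; x1].
Proof.
move=> x01; rewrite /boundary interior_itv -(closure_id _).1;
  last exact: itv_closed.
apply/seteqP; split => y /=; rewrite !in_itv/=.
  move=> [/andP[x0y yx1] /negP]; rewrite negb_and -!leNgt => /orP[|] ?.
    by left; apply/eqP; rewrite eq_le; apply/andP.
  by right; apply/eqP; rewrite eq_le; apply/andP.
by move=> [|] ->; rewrite lexx x01 ltxx ?andbF.
Qed.

Lemma dist_boundary_itvcc {R : realType} (x0 x1 x : R) : x0 < x < x1 ->
  let d := dist x (boundary `[x0, x1]) in
  [/\ 0 < d, d <= x - x0 & d <= x1 - x].
Proof.
move=> /andP[x0x xx1].
rewrite /dist boundary_itvcc; last by rewrite ltW ?(lt_trans x0x).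
set E := edist_inf _ _.
have Ele y : [set x0; x1] y -> (E <= `|x - y|%:E)%E.
  move=> xy; apply/lee_addgt0Pr => e e0.
  apply: (@le_trans _ _ (edist (x, y))).
    by apply: ereal_inf_lbound; exists y.
  apply: edist_fin; first by rewrite ltr_wpDl.
  by rewrite /= /ball/= ltrDl.
(* [edist] is itself an infimum over radii of balls, hence two nested infima. *)
have Ege (m : R) : m <= x - x0 -> m <= x1 - x -> (m%:E <= E)%E.
  move=> m0 m1; apply: le_ereal_inf_tmp => _ [y xy <-].
  apply: le_ereal_inf_tmp => _ [r [r0 +] <-]; rewrite lee_fin /ball/= => xyr.
  apply: le_trans (ltW xyr); case: xy => ->.
    by rewrite ger0_norm// subr_ge0 ltW.
  by rewrite distrC ger0_norm// subr_ge0 ltW.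
(* [fine] sends infinite values to 0, so finiteness comes before any inequality on [dist]. *)
have Efin : E \is a fin_num.
  rewrite ge0_fin_numE ?edist_inf_ge0//.
  by apply: le_lt_trans (Ele x0 _) (ltry _); left.
rewrite -!lee_fin -lte_fin !fineK//; split.
- apply: lt_le_trans (Ege (Num.min (x - x0) (x1 - x)) _ _).
  + by rewrite lte_fin lt_min !subr_gt0 x0x.
  + by rewrite ge_min lexx.
  + by rewrite ge_min lexx orbT.
- by have := Ele x0 (or_introl erefl); rewrite ger0_norm// subr_ge0 ltW.
- by have := Ele x1 (or_intror erefl); rewrite distrC ger0_norm// subr_ge0 ltW.
Qed.

(** * Two-sided derivatives from relative ones, and the derivative of [erf'] *)

Lemma is_derive_within {R : realType} (A : set R) (f : R -> R) (x : R) :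
  interior A x -> derivable_within A f x ->
  is_derive x 1 f (derive_within A f x).
Proof.
move=> Ax df; rewrite derive_within_interior// derive1E; apply: DeriveDef;
  last by [].
rewrite /derivable; move: df => /cvg_ex[l fl]; apply/cvg_ex; exists l.
have -> : (fun h : R => h^-1 *: (f (h *: 1 + x) - f x)) =
    (fun h => h^-1 * (f (h + x) - f x)).
  by apply/funext => h; rewrite [h%:A]mulr1.
apply: cvg_trans fl; apply: cvg_app => P /= AP.
have cx : (h + x) @[h --> (0 : R)] --> x.
  by rewrite -[X in _ --> X]add0r; apply: cvgD; [exact: cvg_id|exact: cvg_cst].
have Ahx : \forall h \near (0 : R)^', A (h + x).
  by apply: nbhs_dnbhs; exact: cx.
have {}AP : \forall h \near (0 : R)^', A (h + x) -> P h by [].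
by apply: filterS2 AP Ahx => h AP Ah; exact: AP.
Qed.

Lemma is_derive_erf' {R : realType} (x : R) :
  is_derive x 1 (@erf' R) (- 2 * x * erf' x).
Proof.
have dsq : is_derive x 1 (fun y : R => - y ^+ 2) (- (2 * x)).
  apply: is_derive_eq (is_deriveN (is_deriveX 2 (is_derive_id x (1 : R)))) _.
  by rewrite /GRing.scale/= expr1 mulr1 mulr_natl.
have := @is_deriveZ _ _ _ _ (2 / Num.sqrt pi) _ _ _
  (@is_derive1_comp _ expR _ x _ _ (is_derive_expR (- x ^+ 2)) dsq).
move=> h; apply: is_derive_eq h _.
by rewrite /erf' /gauss_fun /GRing.scale/=; ring.
Qed.

(** * The self-similar solution used as a barrier *)

Section barrier.
Context {R : realType}.
Variables (c N z : R).
Hypothesis c_gt0 : 0 < c.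
Implicit Types y s : R.

Definition barrier_slope s : R := Num.sqrt c / Num.sqrt s.
Definition barrier_arg y s : R := barrier_slope s * (y - z).
Definition barrier y s : R := N * erf (barrier_arg y s).
Definition barrier_y y s : R := N * (erf' (barrier_arg y s) * barrier_slope s).
Definition barrier_yy y s : R :=
  N * (- 2 * barrier_arg y s * erf' (barrier_arg y s) *
       barrier_slope s * barrier_slope s).

Lemma barrier_slope_gt0 s : 0 < s -> 0 < barrier_slope s.
Proof. by move=> s0; rewrite divr_gt0 ?sqrtr_gt0. Qed.

Let is_derive_arg y s : is_derive y 1 (barrier_arg ^~ s) (barrier_slope s).
Proof.
have := @is_deriveZ _ _ _ _ (barrier_slope s) _ _ _
  (is_deriveB (is_derive_id y (1 : R)) (is_derive_cst z y 1)).
by move=> h; apply: is_derive_eq h _; rewrite /GRing.scale/= subr0 mulr1.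
Qed.

Lemma is_derive_barrier_y y s : is_derive y 1 (barrier ^~ s) (barrier_y y s).
Proof.
have -> : barrier ^~ s = N \*: (@erf R \o (barrier_arg ^~ s)) by [].
have h := @is_derive1_comp _ erf (barrier_arg ^~ s) _ _ _
  (is_derive_erf (barrier_arg y s)) (is_derive_arg y s).
exact: is_derive_eq (@is_deriveZ _ _ _ _ N _ _ _ h) _.
Qed.

Lemma is_derive_barrier_yy y s :
  is_derive y 1 (barrier_y ^~ s) (barrier_yy y s).
Proof.
have := @is_deriveZ _ _ _ _ (N * barrier_slope s) _ _ _
  (@is_derive1_comp _ erf' (barrier_arg ^~ s) _ _ _
    (is_derive_erf' (barrier_arg y s)) (is_derive_arg y s)).
have -> : (N * barrier_slope s) \*: (@erf' R \o (barrier_arg ^~ s)) =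
    barrier_y ^~ s.
  by apply/funext => x; rewrite /barrier_y /= /GRing.scale/=; ring.
move=> h; apply: is_derive_eq h _.
by rewrite /barrier_yy /GRing.scale/=; ring.
Qed.

(** This is the heat equation: [barrier_slope s] is proportional to [s] to the power -1/2, so the
    argument has time derivative [- barrier_arg y s / (2 * s)], while
    [barrier_slope s ^+ 2 = c / s]. *)
Lemma is_derive_barrier_s y s : 0 < s ->
  is_derive s 1 (barrier y) (1 / (4 * c) * barrier_yy y s).
Proof.
move=> s0; have ss0 : Num.sqrt s != 0 by rewrite gt_eqF ?sqrtr_gt0.
have cs0 : Num.sqrt c != 0 by rewrite gt_eqF ?sqrtr_gt0.
have dinv := is_deriveV ss0 (is_derive1_sqrt s0).
have darg := @is_deriveZ _ _ _ _ (Num.sqrt c * (y - z)) _ _ _ dinv.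
have argE : (Num.sqrt c * (y - z)) \*: (fun s' : R => (Num.sqrt s')^-1) =
    barrier_arg y.
  by apply/funext => s'; rewrite /barrier_arg /barrier_slope mulrAC.
rewrite argE in darg.
have h := @is_deriveZ _ _ _ _ N _ _ _
  (@is_derive1_comp _ erf (barrier_arg y) _ _ _
    (is_derive_erf (barrier_arg y s)) darg).
apply: is_derive_eq h _.
rewrite /barrier_yy {2}/barrier_arg /barrier_slope /GRing.scale/=.
(* Writing [c] as the square of its root leaves [field] with roots only; the root of [c] itself is
   restored by [sqrtr_sqr]. *)
rewrite -[in RHS](sqr_sqrtr (ltW c_gt0)) sqrtr_sqr.
rewrite (gtr0_norm (_ : 0 < Num.sqrt c)) ?sqrtr_gt0//.
by field; rewrite ss0 cs0.
Qed.

Lemma continuous_barrier y s : 0 < s ->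
  {for (y, s), continuous (fun p : R * R => barrier p.1 p.2)}.
Proof.
move=> s0; rewrite /barrier; apply: cvgM; first exact: cvg_cst.
apply: continuous_cvg; first exact: continuous_erf.
rewrite /barrier_arg /barrier_slope; apply: cvgM; last first.
  by apply: cvgB; [exact: cvg_fst|exact: cvg_cst].
apply: cvgM; first exact: cvg_cst.
apply: cvgV; first by rewrite gt_eqF ?sqrtr_gt0.
apply: continuous_cvg; first exact: sqrt_continuous.
exact: cvg_snd.
Qed.

Lemma ltr_barrier_arg s a b : 0 < s ->
  (barrier_arg a s < barrier_arg b s) = (a < b).
Proof.
by move=> s0; rewrite /barrier_arg ltr_pM2l ?barrier_slope_gt0// ltrD2r.
Qed.

(** Where the argument is at most [q] in absolute value, the slope is at least
    [N * erf' q * Num.sqrt c / Num.sqrt s0], which exceeds any bound as [s0] tends to 0. *)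
Lemma barrier_y_ge (q L t : R) : 0 < N -> 0 < L -> 0 < t ->
  exists2 s0 : R, 0 < s0 < t &
    forall y, `|barrier_arg y s0| <= q -> L <= barrier_y y s0.
Proof.
move=> N0 L0 t0; pose kp := N * erf' q * Num.sqrt c.
have kp0 : 0 < kp by rewrite mulr_gt0 ?sqrtr_gt0// mulr_gt0 ?erf'_gt0.
(* The second entry is the largest [s0] with [kp / Num.sqrt s0 >= L]; the first keeps [s0] below
   [t]. *)
pose s0 := Num.min (t / 2) ((kp / L) ^+ 2).
have s00 : 0 < s0 by rewrite lt_min divr_gt0//= exprn_gt0 ?divr_gt0.
exists s0 => [|y qy].
  by rewrite s00 gt_min gtr_pMr// invf_lt1// ltr1n.
apply: (@le_trans _ _ (N * (erf' q * barrier_slope s0))).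
  have : Num.sqrt s0 <= kp / L.
    rewrite -(gtr0_norm (divr_gt0 kp0 L0)) -sqrtr_sqr.
    by rewrite ler_sqrt ?sqr_ge0// ge_min lexx orbT.
  rewrite ler_pdivlMr// => sL.
  have -> : N * (erf' q * barrier_slope s0) = kp / Num.sqrt s0.
    by rewrite /kp; move: (erf' q) => g; rewrite -!mulrA.
  by rewrite ler_pdivlMr ?sqrtr_gt0// mulrC.
rewrite /barrier_y ler_pM2l// ler_pM2r ?barrier_slope_gt0//.
rewrite /erf' /gauss_fun ler_pM2l ?divr_gt0 ?sqrtr_gt0 ?pi_gt0//.
rewrite ler_expR lerN2 -[leLHS]real_normK ?num_real// lerXn2r ?nnegrE//.
exact: le_trans qy.
Qed.

(** The height bound on [u] forces the argument above [- q] at [a] and below [q] at [b]. Hence the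
    barrier is steeper than [u] on all of [[a, b]], so [barrier - u] increases there and cannot pass
    from positive to negative. *)
Lemma barrier_order (l r q L s : R) (u ux : R -> R) : 0 < N -> 0 < s ->
  (forall y, l < y < r -> is_derive y 1 u (ux y) /\ ux y < L) ->
  (forall y, l <= y <= r -> `|u y| < N * erf q) ->
  barrier l s < u l -> u r < barrier r s ->
  (forall y, `|barrier_arg y s| <= q -> L <= barrier_y y s) ->
  forall a b, l <= a -> a <= b -> b <= r ->
    u a < barrier a s -> barrier b s < u b -> False.
Proof.
move=> N0 s0 du uq ul ur Lb a b la ab br ua ub.
have {}la : l < a.
  by rewrite lt_neqAle la andbT; apply: contraTneq ua => <-; rewrite -leNgt ltW.
have {}br : b < r.
  by rewrite lt_neqAle br andbT; apply: contraTneq ub => ->; rewrite -leNgt ltW.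
have {}ab : a < b.
  rewrite lt_neqAle ab andbT; apply: contraTneq ub => <-.
  by rewrite -leNgt ltW.
have qa : - q < barrier_arg a s.
  rewrite -ltr_erf erfN -(ltr_pM2l N0) mulrN.
  have /uq : l <= a <= r by rewrite !ltW// (lt_trans ab).
  by rewrite ltr_norml => /andP[/lt_trans + _]; apply.
have bq : barrier_arg b s < q.
  rewrite -ltr_erf -(ltr_pM2l N0).
  have /uq : l <= b <= r by rewrite !ltW// (lt_trans la).
  by rewrite ltr_norml => /andP[_]; apply: lt_trans.
have dD y : a <= y <= b ->
    is_derive y 1 (barrier ^~ s - u) (barrier_y y s - ux y).
  move=> /andP[ay yb]; apply: is_deriveB; first exact: is_derive_barrier_y.
  by apply: (du y _).1; rewrite (lt_le_trans la)// (le_lt_trans yb).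
have [||y] := @MVT _ (barrier ^~ s - u) (fun y => barrier_y y s - ux y) a b ab.
- move=> y; rewrite in_itv/= => /andP[/ltW ay /ltW yb].
  by apply: dD; rewrite ay.
- apply: derivable_within_continuous => y; rewrite in_itv/= => yab.
  by have [] := dD _ yab.
rewrite in_itv/= => /andP[ay yb].
have qy : `|barrier_arg y s| <= q.
  rewrite ler_norml; apply/andP; split; apply/ltW.
    by rewrite (lt_trans qa)// ltr_barrier_arg.
  by rewrite (lt_trans _ bq)// ltr_barrier_arg.
have uy : ux y < L by apply: (du y _).2; rewrite (lt_trans la)// (lt_trans yb).
have : 0 < (barrier_y y s - ux y) * (b - a).
  by rewrite mulr_gt0 ?subr_gt0// (lt_le_trans uy)// Lb.
rewrite !fctE; move: ua ub; clear; lra.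
Qed.

End barrier.

(** * Comparison with the barrier and the gradient bound *)

Theorem theorem8p4 (R : realType) (c M x0 x1 T : R) (u : R -> R -> R) :
  0 < c -> 0 < M -> x0 < x1 -> 0 < T ->
  let Omega : set R := `[x0, x1]%classic in
  let J : set R := `[0, T]%classic in
  smooth_on Omega J u ->
  heat_solution c Omega J u ->
  (forall x t : R, Omega x -> J t -> `|u x t| < M) ->
  (Lip Omega (u ^~ 0%R) < +oo)%E ->
  forall x t : R, interior Omega x -> 0 < t -> t <= T ->
  let N := M * (erf (Num.sqrt c * dist x (boundary Omega)
                     / (2 * Num.sqrt t)))^-1 in
  derive1 (u ^~ t) x <=
    2 * N * Num.sqrt (c / (pi * t)) * expR (- (erf_inv (u x t / N)) ^+ 2).
Proof.
move=> c0 M0 x01 T0 Omega J smooth heat bound _ x t xO t0 tT.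
have xO' := xO; rewrite interior_itv /= in_itv/= in xO'.
have [] := dist_boundary_itvcc _ _ _ xO'; rewrite -/Omega.
set d := dist _ _ => d0 dx0 dx1.
set q := Num.sqrt c * d / _ => /=; set N := M / erf q.
have sl0 s : 0 < s -> 0 < barrier_slope c s by exact: barrier_slope_gt0.
(* Thus [q] is the barrier argument at time [t], at distance [d / 2] to the right of the centre. *)
have qE : q = barrier_slope c t * (d / 2).
  by rewrite /q /barrier_slope; field; rewrite gt_eqF ?sqrtr_gt0.
have q0 : 0 < q by rewrite qE mulr_gt0 ?sl0 ?divr_gt0.
have eq0 : 0 < erf q by rewrite -erf0 ltr_erf.
have N0 : 0 < N by rewrite divr_gt0.
have NM : N * erf q = M by rewrite divfK ?gt_eqF.
clearbody N.
have OmegaP y : x0 <= y <= x1 -> Omega y by rewrite /Omega /= in_itv.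
have JP s : 0 <= s <= T -> J s by rewrite /J /= in_itv.
have uM y s : x0 <= y <= x1 -> 0 <= s <= T -> - M < u y s < M.
  by move=> yO sJ; rewrite -ltr_norml; apply: bound; [exact: OmegaP|exact: JP].
have uN : `|u x t / N| < erf q.
  rewrite normrM normfV (gtr0_norm N0) ltr_pdivrMr// mulrC NM ltr_norml.
  by apply: uM; lra.
set w := erf_inv (u x t / N).
have : `|w| < q by exact: erf_inv_bound.
rewrite ltr_norml => /andP[qw wq].
have ew : N * erf w = u x t.
  by rewrite (erf_invK _ _ uN) mulrC divfK ?gt_eqF.
(* This centre makes the argument at [(x, t)] equal to [w], so the barrier takes the value [u x t]
   there. *)
pose z := x - w / barrier_slope c t.
have argx : barrier_arg c z x t = w.
  by rewrite /barrier_arg /z subKr mulrC divfK ?gt_eqF ?sl0.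
have zx : x - d / 2 < z < x + d / 2.
  have := argx; rewrite /barrier_arg => wE; move: qw wq; rewrite -wE qE -mulrN.
  by rewrite !ltr_pM2l ?sl0//; lra.
clearbody d z.
have slt s : 0 < s -> s <= t -> barrier_slope c t <= barrier_slope c s.
  move=> s0 st; rewrite ler_pM2l ?sqrtr_gt0// lef_pV2 ?posrE ?sqrtr_gt0//.
  by rewrite ler_sqrt// ltW.
have Od y : x - d <= y <= x + d -> x0 <= y <= x1.
  by move: dx0 dx1; clear; lra.
have Odo y : x - d < y < x + d -> x0 < y < x1.
  by move: dx0 dx1; clear; lra.
have Jt s : 0 < s <= t -> 0 <= s <= T.
  by move=> /andP[/ltW-> /le_trans]; apply.
have [contu [deru [contux [derux _ _]] _]] := smooth 2%N.
have inO y : x0 < y < x1 -> interior Omega y.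
  by rewrite interior_itv /= in_itv.
have deruy y s : x0 < y < x1 -> 0 <= s <= T ->
    is_derive y 1 (u ^~ s) (dx Omega u y s).
  move=> yO sJ; apply: is_derive_within; first exact: inO.
  apply: (deru y s _ (JP _ sJ)).1; apply: OmegaP.
  by case/andP: yO => /ltW -> /ltW ->.
pose D y s := barrier c N z y s - u y s.
pose Dy y s := barrier_y c N z y s - dx Omega u y s.
pose Dyy y s := barrier_yy c N z y s - dx Omega (dx Omega u) y s.
have derD y s : x - d < y < x + d -> 0 < s < t ->
  [/\ is_derive y 1 (D ^~ s) (Dy y s), is_derive y 1 (Dy ^~ s) (Dyy y s) &
      is_derive s 1 (D y) (1 / (4 * c) * Dyy y s)].
  move=> /Odo yO /andP[s0 st].
  have Oy : Omega y by apply: OmegaP; case/andP: yO => /ltW -> /ltW ->.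
  have sJ : 0 <= s <= T by apply: Jt; rewrite s0 ltW.
  split.
  - apply: is_deriveB; first exact: is_derive_barrier_y.
    exact: deruy.
  - apply: is_deriveB; first exact: is_derive_barrier_yy.
    apply: is_derive_within; first exact: inO.
    exact: (derux y s Oy (JP _ sJ)).1.
  - rewrite mulrBr; apply: is_deriveB; first exact: is_derive_barrier_s.
    rewrite -(heat _ _ Oy (JP _ sJ)); apply: is_derive_within.
      by rewrite interior_itv /= in_itv/= s0 (lt_le_trans st).
    exact: (deru y s Oy (JP _ sJ)).2.
(* The barrier degenerates at time 0, so the comparison starts at a positive time [s0]. *)
have contD s0 : 0 < s0 -> {within `[x - d, x + d] `*` `[s0, t],
    continuous (fun p : R * R => D p.1 p.2)}.
  move=> s00; apply/subspace_continuousP => -[y s] [/=].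
  rewrite !in_itv/= => yd st; apply: cvgB.
    apply: cvg_within_filter; apply: (continuous_barrier c N z y s).
    by case/andP: st => s0s _; exact: lt_le_trans s0s.
  have sub : `[x - d, x + d] `*` `[s0, t] `<=` Omega `*` J.
    move=> [y' s'] /= []; rewrite !in_itv/= => yd' /andP[s0s' s't].
    split; [exact/OmegaP/Od|apply/JP/Jt].
    by rewrite (lt_le_trans s00).
  have /subspace_continuousP := continuous_subspaceW sub contu.
  by apply; split; rewrite /= in_itv.
have lx : x - d <= x - d <= x + d by rewrite lexx/= lerD2l ge0_cp// ltW.
have xr : x - d <= x + d <= x + d by rewrite lexx andbT lerD2l ge0_cp// ltW.
(* The point [x - d] is more than [d / 2] to the left of [z], and the slope at time [s] is at least
   that at time [t]. So the argument is at most [- q] and the barrier at most [- M]. *)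
have leftD s : 0 < s <= t -> barrier c N z (x - d) s < u (x - d) s.
  move=> st; apply: (@le_lt_trans _ _ (- M)); last first.
    by have /andP[] := uM _ _ (Od _ lx) (Jt _ st).
  case/andP: st => s0 st; rewrite -NM -mulrN -erfN ler_pM2l// leNgt ltr_erf.
  rewrite -leNgt /barrier_arg qE.
  by move: (slt _ s0 st) (sl0 _ t0) zx d0; clear; nra.
have rightD s : 0 < s <= t -> u (x + d) s < barrier c N z (x + d) s.
  move=> st; apply: (@lt_le_trans _ _ M).
    by have /andP[] := uM _ _ (Od _ xr) (Jt _ st).
  case/andP: st => s0 st; rewrite -NM ler_pM2l// leNgt ltr_erf.
  rewrite -leNgt /barrier_arg qE.
  by move: (slt _ s0 st) (sl0 _ t0) zx d0; clear; nra.
(* The derivative of [u] in space is continuous on a compact rectangle, hence bounded. In [L], one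
   unit passes strictly above [B] and the other makes the bound strict. *)
have [L L0 uxL] : exists2 L : R, 0 < L & forall y s, x0 <= y <= x1 ->
    0 <= s <= T -> dx Omega u y s < L.
  have compactOJ : compact (Omega `*` J).
    by apply: compact_setX; exact: segment_compact.
  have [B [_ uxB]] := compact_bounded (continuous_compact contux compactOJ).
  exists (`|B| + 2); first by rewrite ltr_wpDl.
  move=> y s yO sJ; apply: (@le_lt_trans _ _ (`|B| + 1)); last lra.
  apply: le_trans (ler_norm _) _; apply: uxB.
    by rewrite ltr_pwDr// ler_norm.
  by exists (y, s).
(* At time [s0] the barrier is steeper than [u] wherever its absolute value is at most
   [M = N * erf q]. *)
have [s0 /andP[s00 s0t] Lb] := barrier_y_ge c N z c0 q L t N0 L0 t0.
have s0T : 0 < s0 <= t by rewrite s00 ltW.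
have initD a b : x - d <= a -> a <= b -> b <= x + d ->
    0 < D a s0 -> D b s0 < 0 -> False.
  rewrite subr_gt0 subr_lt0.
  apply: (@barrier_order R c N z c0 _ _ q L s0
    (u ^~ s0) (dx Omega u ^~ s0)) => //.
  - move=> y yd; split; first exact: deruy (Odo _ yd) (Jt _ s0T).
    by apply: uxL (Jt _ s0T); apply: Od; case/andP: yd => /ltW -> /ltW ->.
  - by move=> y yd; rewrite NM ltr_norml; exact: uM (Od _ yd) (Jt _ s0T).
  - exact: leftD.
  - exact: rightD.
rewrite -(derive_within_interior _ xO) -/(dx Omega u x t).
have -> : 2 * N * Num.sqrt (c / (pi * t)) * expR (- w ^+ 2) =
    barrier_y c N z x t.
  rewrite /barrier_y argx /barrier_slope /erf' /gauss_fun.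
  rewrite sqrtrM ?(ltW c0)// sqrtrV ?mulr_ge0 ?pi_ge0 ?(ltW t0)//.
  rewrite sqrtrM ?pi_ge0//; field.
  by rewrite !gt_eqF ?sqrtr_gt0 ?pi_gt0.
(* If the bound fails, [D ^~ t] has negative derivative at its zero [x], so it is positive just to
   the left and negative just to the right: the sign change excluded by [no_sign_change]. *)
rewrite -subr_ge0 leNgt -oppr_gt0; apply/negP => Dx0.
have dD : is_derive x 1 (- (D ^~ t)) (- Dy x t).
  apply/is_deriveN/is_deriveB; first exact: is_derive_barrier_y.
  by apply: deruy => //; apply: Jt; rewrite t0/=.
have [e e0 De] := is_derive_gt0_near _ _ _ dD Dx0.
have Dxt : D x t = 0 by rewrite /D /barrier argx ew subrr.
have [h h0 [he hd]] : exists2 h : R, 0 < h & h < e /\ h <= d.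
  exists (Num.min (e / 2) d); first by rewrite lt_min d0 divr_gt0.
  by rewrite gt_min ge_min lexx orbT gtr_pMr// invf_lt1// ltr1n.
have /De : 0 < h < e by rewrite h0.
rewrite !fctE Dxt oppr0 oppr_lt0 oppr_gt0 => /andP[Dl Dr].
have k0 : 0 < 1 / (4 * c) by rewrite divr_gt0// mulr_gt0.
have s0_t s : s0 <= s <= t -> 0 < s <= t.
  by move=> /andP[s0s ->]; rewrite (lt_le_trans s00).
have derD0 y s : x - d < y < x + d -> s0 < s < t ->
  [/\ is_derive y 1 (D ^~ s) (Dy y s), is_derive y 1 (Dy ^~ s) (Dyy y s) &
      is_derive s 1 (D y) (1 / (4 * c) * Dyy y s)].
  by move=> yd /andP[s0s st]; apply: derD; rewrite ?(lt_trans s00).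
have leftD0 s : s0 <= s <= t -> D (x - d) s <= 0.
  by move=> /s0_t/leftD/ltW; rewrite subr_le0.
have rightD0 s : s0 <= s <= t -> 0 <= D (x + d) s.
  by move=> /s0_t/rightD/ltW; rewrite subr_ge0.
apply: (no_sign_change (x - d) (x + d) s0 t (1 / (4 * c)) D Dy Dyy k0 s0t
  (contD _ s00) derD0 leftD0 rightD0 initD (x - h) (x + h) t _ _ _ _ Dl Dr).
- by rewrite lerD2l lerN2.
- by rewrite lerD2l ge0_cp// ltW.
- by rewrite lerD2l.
- by rewrite lexx andbT ltW.
Qed.
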